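(* Let $s\ge 2$ be a fixed integer. Seeded $s$-Club, parameterized by $k$, restricted to instances $(G,W,k)$ in which $W$ is a clique in $G$, admits a kernel with $\mathcal{O}(k^{2|W|+1})$ vertices.
   Context: Seeded $s$-Club: given an undirected graph $G=(V,E)$, a set $W\subseteq V$ and an integer $k\ge 1$, decide whether $G$ contains a vertex set $S$ with $W\subseteq S$, $|S|\ge k$, and $G[S]$ of diameter at most $s$. It is assumed throughout that $|W|<k$. A kernel is a polynomial-time algorithm mapping each instance to an equivalent instance of the same problem, here with the stated number of vertices.
   Formalization: The seed W is required to be nonempty; for W empty the claim would give plain s-Club an O(k)-vertex kernel, which is impossible unless coNP is contained in NP/poly. *)

(* Defs.v *)
From HB Require Import structures.
From mathcomp Require Import all_boot.
Set Implicit Arguments.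
Unset Strict Implicit.
Unset Printing Implicit Defensive.

(** * Seeded s-Club *)

Record graph := Graph {
  nv : nat;
  adj : rel 'I_nv;
  adj_sym : symmetric adj;
  adj_irrefl : irreflexive adj
}.

Definition induced (G : graph) (S : {set 'I_(nv G)}) : rel 'I_(nv G) :=
  [rel u v | [&& u \in S, v \in S & adj u v]].

(* [size p] is the number of edges of the walk [u :: p]. *)
Definition dist_le (T : finType) (e : rel T) (d : nat) (u v : T) : Prop :=
  exists p : seq T, [/\ path e u p, last u p = v & size p <= d].

Definition diam_le (G : graph) (S : {set 'I_(nv G)}) (s : nat) : Prop :=
  forall u v, u \in S -> v \in S -> dist_le (induced S) s u v.

Definition clique (G : graph) (W : {set 'I_(nv G)}) : Prop :=
  forall u v, u \in W -> v \in W -> u != v -> adj u v.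

Record instance := Instance {
  gr : graph;
  seeds : {set 'I_(nv gr)};
  par : nat
}.

Definition seeded_club (s : nat) (I : instance) : Prop :=
  exists S : {set 'I_(nv (gr I))},
    [/\ seeds I \subset S, par I <= #|S| & diam_le S s].

(* A seed is nonempty: for W empty the problem is plain s-Club, which has no
   polynomial kernel for the parameter k unless coNP is in NP/poly. *)
Definition clique_instance (I : instance) : Prop :=
  [/\ 0 < par I, seeds I != set0, #|seeds I| < par I & clique (seeds I)].

(** * Random access machine

  Structured programs over finitely many unbounded arrays of natural numbers,
  with unit cost per assignment and per test. Addition and truncated
  subtraction are the only arithmetic operations, so bit lengths grow by at
  most a program-dependent constant per step, and polynomial time here
  coincides with polynomial time on Turing machines. A scalar variable is
  cell 0 of an array. *)

Definition store := nat -> nat -> nat.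

Inductive expr :=
| Lit of nat
| Get of nat & expr
| Plus of expr & expr
| Minus of expr & expr.

Inductive cmd :=
| Skip
| Put of nat & expr & expr
| Then of cmd & cmd
| If of expr & cmd & cmd
| While of expr & cmd.

Fixpoint eval (st : store) (e : expr) : nat :=
  match e with
  | Lit n => n
  | Get a i => st a (eval st i)
  | Plus e1 e2 => eval st e1 + eval st e2
  | Minus e1 e2 => eval st e1 - eval st e2
  end.

Definition update (st : store) (a i x : nat) : store :=
  fun b j => if (b == a) && (j == i) then x else st b j.

(* [exec c st st' t]: started on [st], [c] halts on [st'] after [t] steps.
   Tests succeed on nonzero values. *)
Inductive exec : cmd -> store -> store -> nat -> Prop :=
| ExecSkip st :
    exec Skip st st 1
| ExecPut a i e st :
    exec (Put a i e) st (update st a (eval st i) (eval st e)) 1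
| ExecThen c1 c2 st1 st2 st3 t1 t2 :
    exec c1 st1 st2 t1 -> exec c2 st2 st3 t2 ->
    exec (Then c1 c2) st1 st3 (t1 + t2)
| ExecIfTrue e c1 c2 st st' t :
    eval st e != 0 -> exec c1 st st' t -> exec (If e c1 c2) st st' t.+1
| ExecIfFalse e c1 c2 st st' t :
    eval st e = 0 -> exec c2 st st' t -> exec (If e c1 c2) st st' t.+1
| ExecWhileDone e c st :
    eval st e = 0 -> exec (While e c) st st 1
| ExecWhileStep e c st1 st2 st3 t1 t2 :
    eval st1 e != 0 -> exec c st1 st2 t1 -> exec (While e c) st2 st3 t2 ->
    exec (While e c) st1 st3 (t1 + t2).+1.

(** * Kernels *)

(* Number of vertices, k, membership in W, adjacency matrix by rows. *)
Definition encoding (I : instance) : seq (seq nat) :=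
  [:: [:: nv (gr I)];
      [:: par I];
      [seq nat_of_bool (v \in seeds I) | v <- enum 'I_(nv (gr I))];
      [seq nat_of_bool (adj u v)
         | u <- enum 'I_(nv (gr I)), v <- enum 'I_(nv (gr I))]].

(* All cells outside the encoding are initially 0. *)
Definition load (I : instance) : store :=
  fun a i => nth 0 (nth [::] (encoding I) a) i.

(* Cells outside the encoding may hold anything when the program halts. *)
Definition holds (st : store) (I : instance) : Prop :=
  forall a i, i < size (nth [::] (encoding I) a) -> st a i = load I a i.

Definition bit_length (n : nat) : nat := (trunc_log 2 n).+1.

Definition input_size (I : instance) : nat :=
  sumn [seq bit_length x | x <- flatten (encoding I)].

(* As [input_size I >= 1], every polynomial is dominated by some [a * x ^ d]. *)
Definition poly_time_on (D : instance -> Prop) (f : instance -> instance) :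
    Prop :=
  exists (P : cmd) (a d : nat), forall I, D I ->
    exists (st : store) (t : nat),
      [/\ exec P (load I) st t, holds st (f I) & t <= a * input_size I ^ d].

(* [D] is the set of instances and [yes] the set of yes-instances of the
   problem parameterized by [par]. *)
Definition kernel (D yes : instance -> Prop) (f : instance -> instance) :
    Prop :=
  [/\ poly_time_on D f,
      forall I, D I -> D (f I),
      forall I, D I -> (yes I <-> yes (f I)) &
      exists g : nat -> nat, forall I, D I ->
        nv (gr (f I)) + par (f I) <= g (par I)].

(* Main.v *)
(* A seed clique W lies in the ball of radius s/2 around each w in W, and that
   ball is an s-club; for odd s it can be enlarged by the neighbourhood of any
   one of its vertices. So in a no-instance the balls of radius ceil(s/2)
   around the seeds have at most k^2 vertices. Every vertex v of an s-club
   containing W reaches each w through a midpoint m(w) in such a ball, and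
   there are at most k^(2|W|) choices of m. If k vertices share the same m,
   then they form, together with all short walks through these midpoints, an
   s-club. Hence a no-instance has at most k^(2|W|+1) vertices at distance at
   most s from all of W: the kernel keeps these vertices, or answers yes when
   there are more. *)
Require Import Defs.
From HB Require Import structures.
From mathcomp Require Import all_boot.
From mathcomp Require Import zify.
Set Implicit Arguments.
Unset Strict Implicit.
Unset Printing Implicit Defensive.

(** * Distances and balls *)

Section Dist.
Context (T : finType) (e : rel T).

Lemma dist_le_refl d u : dist_le e d u u.
Proof. by exists [::]. Qed.

Lemma dist_leW a b u v : a <= b -> dist_le e a u v -> dist_le e b u v.
Proof. by move=> ab [p [ep lp sp]]; exists p; split=> //; apply: leq_trans ab. Qed.

Lemma dist_le_trans a b v u w :
  dist_le e a u v -> dist_le e b v w -> dist_le e (a + b) u w.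
Proof.
move=> [p [ep lp sp]] [q [eq lq sq]]; exists (p ++ q).
by rewrite cat_path last_cat ep lp eq lq size_cat leq_add.
Qed.

Lemma dist_le_edge d u v : 0 < d -> e u v -> dist_le e d u v.
Proof. by move=> d0 uv; exists [:: v]; rewrite /= uv. Qed.

Lemma dist_le_sym d u v : symmetric e -> dist_le e d u v -> dist_le e d v u.
Proof.
move=> es [p [ep lp sp]]; exists (rev (belast u p)); split.
- rewrite -lp rev_path; under eq_path => x y do rewrite es; exact: ep.
- by case: p ep lp sp => //= x p _ _ _; rewrite rev_cons last_rcons.
- by rewrite size_rev size_belast.
Qed.

(** Decidable form of [dist_le], needed to count balls; growing one layer at a time, it is also the
    recursion that the program follows. *)
Fixpoint ball (r : nat) (u : T) : {set T} :=
  if r is r'.+1 then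
    [set v | [exists x, (x \in ball r' u) && ((x == v) || e x v)]]
  else [set u].

Lemma ballP r u v : reflect (dist_le e r u v) (v \in ball r u).
Proof.
apply: (iffP idP); elim: r v => [|r IH] v /=.
- by rewrite inE => /eqP->; apply: dist_le_refl.
- rewrite inE => /existsP[x /andP[/IH ux /orP[/eqP<-|xv]]].
    exact: dist_leW ux.
  by rewrite -addn1; apply: dist_le_trans ux _; apply: dist_le_edge.
- by case=> -[|x p] [_ /= <-]; rewrite ?inE.
- case=> p [+ + +]; case/lastP: p => [_ /= <- _|p y]; rewrite inE.
    by apply/existsP; exists u; rewrite eqxx IH //; apply: dist_le_refl.
  rewrite rcons_path last_rcons size_rcons => /andP[ep xy] <- sp.
  by apply/existsP; exists (last u p); rewrite xy orbT andbT IH //; exists p.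
Qed.

End Dist.

Lemma ball_sub (T : finType) (e : rel T) a b u : a <= b -> ball e a u \subset ball e b u.
Proof. by move=> ab; apply/subsetP=> v /ballP uv; apply/ballP/(dist_leW ab). Qed.

(** * Walks that stay inside an induced subgraph *)

Section Graph.
Context (G : graph).
Implicit Types (S W : {set 'I_(nv G)}) (u v w x : 'I_(nv G)).

Lemma induced_sym S : symmetric (induced S).
Proof. by move=> u v; rewrite /induced /= adj_sym andbCA. Qed.

Lemma induced_dist_sub S d u v : dist_le (induced S) d u v -> dist_le (@adj G) d u v.
Proof.
case=> p [ep lp sp]; exists p; split=> //.
by apply: sub_path ep => x y /and3P[].
Qed.

(** A walk found layer by layer from the centre visits only vertices of smaller balls around the
    same centre, so it never leaves [S]. *)
Lemma induced_ball S r w x :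
  ball (@adj G) r w \subset S -> x \in ball (@adj G) r w ->
  dist_le (induced S) r x w.
Proof.
move=> sub xw; apply: dist_le_sym (induced_sym S) _.
elim: r x sub xw => [|r IH] x sub; first by rewrite inE => /eqP->; apply: dist_le_refl.
move=> xw; have xS := subsetP sub _ xw; move: xw; rewrite inE.
have sub' := subset_trans (ball_sub (@adj G) w (leqnSn r)) sub.
case/existsP=> y /andP[yw /orP[/eqP<-|yx]]; first exact/(dist_leW (leqnSn r))/IH.
rewrite -addn1; apply: dist_le_trans (IH _ sub' yw) _.
by apply: dist_le_edge => //; rewrite /induced /= xS (subsetP sub' _ yw).
Qed.

(** The vertices on walks of length at most [r] between [a] and [b]; the index [i] says how [r] is
    split between the two ends. *)
Definition segment r a b : {set 'I_(nv G)} :=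
  [set x | [exists i : 'I_r.+1,
     (x \in ball (@adj G) i a) && (x \in ball (@adj G) (r - i) b)]].

Lemma segmentP r a b x :
  reflect (exists2 i, i <= r &
             dist_le (@adj G) i a x /\ dist_le (@adj G) (r - i) b x)
          (x \in segment r a b).
Proof.
rewrite inE; apply: (iffP existsP) => [[i /andP[/ballP xa /ballP xb]]|[i ir [xa xb]]].
  by exists i => //; rewrite -ltnS.
by exists (Ordinal (ir : i < r.+1)); apply/andP; split; apply/ballP.
Qed.

Lemma segmentC r a b : segment r a b = segment r b a.
Proof.
apply/setP=> x; apply/segmentP/segmentP => -[i ir [xa xb]];
  by exists (r - i); rewrite ?leq_subr // subKn.
Qed.

(** The predecessor of [x] on a walk from [a] is one step closer to [a] and at most one step farther
    from [b]. It therefore lies in the segment too, and by induction so does the whole walk. *)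
Lemma segment_dist S r a b i x :
  segment r a b \subset S -> i <= r ->
  dist_le (@adj G) i a x -> dist_le (@adj G) (r - i) b x ->
  dist_le (induced S) i a x.
Proof.
move=> /subsetP sub; elim: i x => [|i IH] x ir xa xb.
  by case: xa => -[|y p] [_ /= <-] // _; apply: dist_le_refl.
have xS : x \in S by apply/sub/segmentP; exists i.+1.
case: xa => p [+ + +]; case/lastP: p => [_ /= <- _|p y]; first exact: dist_le_refl.
rewrite rcons_path last_rcons size_rcons => /andP[ep xy] yE; rewrite {y}yE in xy *.
move=> sp; set y := last a p in xy.
have ay : dist_le (@adj G) i a y by exists p.
have yb : dist_le (@adj G) (r - i) b y.
  rewrite (_ : r - i = r - i.+1 + 1); last by lia.
  by apply: dist_le_trans xb _; apply: dist_le_edge; rewrite // adj_sym.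
have yS : y \in S by apply/sub/segmentP; exists i => //; lia.
rewrite -addn1; apply: dist_le_trans (IH y _ ay yb) _; first by lia.
by apply: dist_le_edge => //; rewrite /induced /= xS yS.
Qed.

(** * Clubs built around a seed clique *)

Lemma clique_dist S W w w' :
  clique W -> W \subset S -> w \in W -> w' \in W -> dist_le (induced S) 1 w w'.
Proof.
move=> cW /subsetP WS wW w'W; have [->|ne] := eqVneq w w'; first exact: dist_le_refl.
by apply: dist_le_edge => //; rewrite /induced /= !WS ?cW.
Qed.

Lemma clique_ball W w r : clique W -> w \in W -> 0 < r -> W \subset ball (@adj G) r w.
Proof.
move=> cW wW r0; apply/subsetP=> w' w'W; apply/ballP.
have := clique_dist cW (subxx W) wW w'W.
by move/induced_dist_sub; apply: dist_leW.
Qed.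

(** Two vertices of the ball meet at its centre after [s./2] steps each. As [s] is at least 2, the
    radius is positive, so the ball contains the clique. *)
Lemma ball_club W w s : clique W -> w \in W -> 1 < s ->
  exists S, [/\ W \subset S, #|ball (@adj G) s./2 w| <= #|S| & diam_le S s].
Proof.
move=> cW wW s2; exists (ball (@adj G) s./2 w); split=> //.
  by apply: clique_ball => //; lia.
move=> u v uB vB; apply: (@dist_leW _ _ (s./2 + s./2)); first by lia.
apply: (@dist_le_trans _ _ _ _ w); first exact: induced_ball.
by apply: dist_le_sym (induced_sym _) _; apply: induced_ball.
Qed.

(** For odd [s] the budget exceeds [2 * s./2] by one. This extra step brings a neighbour of [u] to
    [u], from where the route through [w] reaches the rest of the ball; two neighbours of [u] meet
    in [u]. *)
Lemma ball_nbh_club W w u s : clique W -> w \in W -> 1 < s -> odd s ->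
  u \in ball (@adj G) s./2 w ->
  exists S, [/\ W \subset S, #|ball (@adj G) 1 u| <= #|S| & diam_le S s].
Proof.
move=> cW wW s2 os uB; set A := ball _ _ w in uB; set B := ball _ 1 u.
exists (A :|: B); split; first 2 last.
- set S := A :|: B.
  have dA x : x \in A -> dist_le (induced S) s./2 x w.
    by apply: induced_ball; apply: subsetUl.
  have dB x : x \in B -> dist_le (induced S) 1 x u.
    by apply: induced_ball; apply: subsetUr.
  have dAB x y : x \in A -> y \in B -> dist_le (induced S) s x y.
    move=> xA yB; apply: (@dist_leW _ _ (s./2 + (s./2 + 1))); first by lia.
    apply: dist_le_trans (dA _ xA) _.
    apply: dist_le_sym (induced_sym _) _; rewrite addnC.
    exact: dist_le_trans (dB _ yB) (dA _ uB).
  move=> x y /setUP[xA|xB] /setUP[yA|yB].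
  + apply: (@dist_leW _ _ (s./2 + s./2)); first by lia.
    apply: dist_le_trans (dA _ xA) _.
    exact: dist_le_sym (induced_sym _) (dA _ yA).
  + exact: dAB.
  + by apply: dist_le_sym (induced_sym _) _; apply: dAB.
  + apply: (@dist_leW _ _ (1 + 1)); first by lia.
    apply: dist_le_trans (dB _ xB) _.
    exact: dist_le_sym (induced_sym _) (dB _ yB).
- by apply: subset_trans (subsetUl _ _); apply: clique_ball => //; lia.
- exact/subset_leq_card/subsetUr.
Qed.

(* Any two vertices of the union of the segments lie on a common closed walk
   of length at most [2 * s + 1], hence at distance at most [s]. *)
Lemma midpoint_club W F (m : 'I_(nv G) -> 'I_(nv G)) s :
  clique W -> W != set0 -> F != set0 ->
  (forall w, w \in W -> m w \in ball (@adj G) (s - s./2) w) ->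
  (forall w v, w \in W -> v \in F -> v \in ball (@adj G) s./2 (m w)) ->
  exists S, [/\ W \subset S, F \subset S & diam_le S s].
Proof.
move=> cW /set0Pn[w0 w0W] /set0Pn[v0 v0F] mW mF.
pose X := \bigcup_(w in W) segment (s - s./2) w (m w).
pose Z := \bigcup_(w in W) \bigcup_(v in F) segment s./2 v (m w).
pose S := X :|: Z; exists S.
have sX w : w \in W -> segment (s - s./2) w (m w) \subset S.
  by move=> wW; apply: subset_trans (subsetUl _ _); apply: bigcup_max wW _.
have sZ w v : w \in W -> v \in F -> segment s./2 v (m w) \subset S.
  move=> wW vF; apply: subset_trans (subsetUr _ _); apply: bigcup_max wW _.
  exact: bigcup_max vF _.
have WS : W \subset S.
  apply/subsetP=> w wW; apply/(subsetP (sX _ wW))/segmentP; exists 0 => //.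
  split; first exact: dist_le_refl.
  by rewrite subn0; apply: dist_le_sym (@adj_sym G) _; apply/ballP/mW.
have Fmid w v : w \in W -> v \in F -> v \in segment s./2 v (m w).
  move=> wW vF; apply/segmentP; exists 0 => //.
  by split; [exact: dist_le_refl | rewrite subn0; apply/ballP/mF].
have FS : F \subset S.
  by apply/subsetP=> v vF; apply/(subsetP (sZ _ _ w0W vF))/Fmid.
split=> //.
pose d := dist_le (induced S); have dC a x y : d a x y -> d a y x.
  exact: dist_le_sym (induced_sym S).
have dXP x : x \in X -> exists w b,
    [/\ w \in W, b <= s - s./2, d b w x & d (s - s./2 - b) (m w) x].
  case/bigcupP=> w wW /segmentP[b bt [xa xb]]; exists w, b; split=> //.
    exact: segment_dist (sX _ wW) _ _ _.
  by apply: (segment_dist (b := w)) (leq_subr _ _) xb _;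
    rewrite ?subKn // segmentC sX.
have dZP z : z \in Z -> exists w v a,
    [/\ w \in W, v \in F, a <= s./2, d a v z & d (s./2 - a) (m w) z].
  case/bigcupP=> w wW /bigcupP[v vF /segmentP[a at_ [za zb]]].
  exists w, v, a; split=> //; first exact: segment_dist (sZ _ _ wW vF) _ _ _.
  by apply: (segment_dist (b := v)) (leq_subr _ _) zb _;
    rewrite ?subKn // segmentC sZ.
have dvm w v : w \in W -> v \in F -> d s./2 v (m w).
  move=> wW vF; apply: (segment_dist (sZ _ _ wW vF)) (leqnn _) _ _.
    by apply: dist_le_sym (@adj_sym G) _; apply/ballP/mF.
  by rewrite subnn; apply: dist_le_refl.
have dwm w : w \in W -> d (s - s./2) w (m w).
  move=> wW; apply: (segment_dist (sX _ wW)) (leqnn _) _ _; first exact/ballP/mW.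
  by rewrite subnn; apply: dist_le_refl.
have dww w w' : w \in W -> w' \in W -> d 1 w w' by apply: clique_dist.
(* The closed walk [v], [m w], [w], [w'], [m w'], [v] has length at most [2 * s + 1]. Its two arcs
   between [z] and [x] share this length, and comparing the offsets [a] and [b] selects an arc of
   length at most [s]. *)
have dZX z x : z \in Z -> x \in X -> d s z x.
  move=> /dZP[w [v [a [wW vF at_ vz mz]]]] /dXP[w' [b [w'W bt wx mx]]].
  have [ab|ba] := leqP a b.
    apply: (@dist_leW _ _ (a + (s./2 + (s - s./2 - b)))); first by lia.
    exact: dist_le_trans (dC _ _ _ vz) (dist_le_trans (dvm _ _ w'W vF) mx).
  apply: (@dist_leW _ _ ((s./2 - a) + ((s - s./2) + (1 + b)))); first by lia.
  apply: dist_le_trans (dC _ _ _ mz) (dist_le_trans (dC _ _ _ (dwm _ wW)) _).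
  exact: dist_le_trans (dww _ _ wW w'W) wx.
move=> x y /setUP[] xS /setUP[] yS; last first.
(* Here the closed walk is [v], [m w], [v'], [m w'], [v], made of four pieces of length [s./2]. *)
- move: xS yS => /dZP[w [v [a [wW vF at_ vz mz]]]] /dZP[w' [v' [b [w'W v'F bt wx mx]]]].
  have [ab|ba] := leqP a b.
    apply: (@dist_leW _ _ (a + (s./2 + (s./2 - b)))); first by lia.
    exact: dist_le_trans (dC _ _ _ vz) (dist_le_trans (dvm _ _ w'W vF) mx).
  apply: (@dist_leW _ _ ((s./2 - a) + (s./2 + b))); first by lia.
  exact: dist_le_trans (dC _ _ _ mz) (dist_le_trans (dC _ _ _ (dvm _ _ wW v'F)) wx).
- exact: dZX.
- exact/dC/dZX.
(* Here the closed walk is [w], [m w], [v0], [m w'], [w'], [w]. The arc through [v0] has length at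
   most [2 * s - (a + b)], the arc through the seeds [a + b + 1]. *)
- move: xS yS => /dXP[w [a [wW at_ wz mz]]] /dXP[w' [b [w'W bt wx mx]]].
  have [ab|ba] := leqP s (a + b).
    apply: (@dist_leW _ _
      ((s - s./2 - a) + (s./2 + (s./2 + (s - s./2 - b))))); first by lia.
    apply: dist_le_trans (dC _ _ _ mz) (dist_le_trans (dC _ _ _ (dvm _ _ wW v0F)) _).
    exact: dist_le_trans (dvm _ _ w'W v0F) mx.
  apply: (@dist_leW _ _ (a + (1 + b))); first by lia.
  exact: dist_le_trans (dC _ _ _ wz) (dist_le_trans (dww _ _ wW w'W) wx).
Qed.

(** * Bounding the set of candidate vertices *)

Definition reach s W : {set 'I_(nv G)} :=
  [set v | [forall w in W, v \in ball (@adj G) s w]].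

(** Distances in [G[S]] are at least those in [G]; hence vertices outside [reach] can be discarded
    safely. *)
Lemma club_reach s W S : W \subset S -> diam_le S s -> S \subset reach s W.
Proof.
move=> /subsetP WS dS; apply/subsetP=> v vS; rewrite inE; apply/forall_inP=> w wW.
by apply/ballP/induced_dist_sub/dS => //; apply: WS.
Qed.

(** For even [s] the ball is itself a club and has at most [k] vertices. For odd [s] it is covered
    by the unit balls around the at most [k] vertices of the ball of radius [s./2], each of which
    has at most [k] vertices. *)
Lemma ball_half s W k w : clique W -> w \in W -> 1 < s ->
  (forall S, W \subset S -> diam_le S s -> #|S| < k) ->
  #|ball (@adj G) (s - s./2) w| <= k ^ 2.
Proof.
move=> cW wW s2 noS.
have bt : #|ball (@adj G) s./2 w| <= k.
  have [S [WS le dS]] := ball_club cW wW s2.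
  exact: leq_trans le (ltnW (noS _ WS dS)).
have [os|es] := boolP (odd s); last first.
  rewrite (_ : s - s./2 = s./2); last by lia.
  apply: leq_trans bt _; nia.
rewrite (_ : s - s./2 = s./2.+1); last by lia.
have sub : ball (@adj G) s./2.+1 w \subset
    \bigcup_(u in ball (@adj G) s./2 w) ball (@adj G) 1 u.
  apply/subsetP=> v; rewrite inE => /existsP[u /andP[uB uv]].
  apply/bigcupP; exists u => //; rewrite inE.
  by apply/existsP; exists u; rewrite inE eqxx.
apply: leq_trans (subset_leq_card sub) _.
have le : #|\bigcup_(u in ball (@adj G) s./2 w) ball (@adj G) 1 u|
    <= \sum_(u in ball (@adj G) s./2 w) #|ball (@adj G) 1 u|.
  elim/big_rec2: _ => [|u n A _ IH]; first by rewrite cards0.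
  by rewrite (leq_trans (leq_card_setU _ _)) // leq_add2l.
apply: leq_trans le _; apply: (@leq_trans (\sum_(u in ball (@adj G) s./2 w) k)).
  apply: leq_sum => u uB; have [S [WS le dS]] := ball_nbh_club cW wW s2 os uB.
  exact: leq_trans le (ltnW (noS _ WS dS)).
by rewrite sum_nat_const leq_mul2r bt orbT.
Qed.

Lemma diam_leP S s :
  reflect (diam_le S s)
    [forall u in S, forall v in S, v \in ball (induced S) s u].
Proof.
apply: (iffP forall_inP) => [dS u v uS vS|dS u uS].
  exact/ballP/(forall_inP (dS u uS)).
by apply/forall_inP=> v vS; apply/ballP/dS.
Qed.

Lemma large_reach_club s W k :
  clique W -> W != set0 -> 1 < s -> 0 < k -> k ^ (2 * #|W| + 1) < #|reach s W| ->
  exists S, [/\ W \subset S, k <= #|S| & diam_le S s].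
Proof.
move=> cW W0 s2 k0 large.
(* A club with [k] vertices settles the goal at once; otherwise its absence is the hypothesis under
   which [ball_half] bounds the balls. *)
have [/existsP[S /and3P[WS kS /diam_leP dS]]|/existsPn no] := boolP
  [exists S : {set 'I_(nv G)}, [&& W \subset S, k <= #|S| &
    [forall u in S, forall v in S, v \in ball (induced S) s u]]].
  by exists S.
have noS S : W \subset S -> diam_le S s -> #|S| < k.
  move=> WS /diam_leP dS; have := no S; rewrite WS dS andbT /=.
  by rewrite -ltnNge.
(* The default [w] is never reached for [v] in [reach s W], as [midP] shows. *)
pose mid v w := odflt w
  [pick u | (u \in ball (@adj G) (s - s./2) w) && (v \in ball (@adj G) s./2 u)].
have midP v w : v \in reach s W -> w \in W ->
    (mid v w \in ball (@adj G) (s - s./2) w) && (v \in ball (@adj G) s./2 (mid v w)).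
  rewrite inE => /forall_inP vR /vR /ballP[p [ep lp sp]]; rewrite /mid.
  case: pickP => // none.
  (* The walk of length at most [s] from [w] to [v] is cut after [s - s./2] edges, leaving at most
     [s./2]. *)
  have := none (last w (take (s - s./2) p)).
  rewrite -{1}(cat_take_drop (s - s./2) p) cat_path in ep.
  rewrite -{1}(cat_take_drop (s - s./2) p) last_cat in lp.
  case/andP: ep => ep1 ep2.
  case/andP; split; apply/ballP.
    by exists (take (s - s./2) p); rewrite size_take_min geq_minl.
  by exists (drop (s - s./2) p); split=> //; rewrite size_drop; lia.
(* Outside [W] the factor is a singleton and [f v] is the identity, so [family D] counts choices of
   midpoints for the seeds only. *)
pose D w : {set 'I_(nv G)} := if w \in W then ball (@adj G) (s - s./2) w else [set w].
pose f v : {ffun 'I_(nv G) -> 'I_(nv G)} := [ffun w => if w \in W then mid v w else w].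
have cD : #|family D| <= (k ^ 2) ^ #|W|.
  rewrite card_family foldrE big_map big_enum /= (bigID (mem W)) /=.
  rewrite [X in _ * X]big1 ?muln1 => [|w /negbTE wW]; last by rewrite /D wW cards1.
  rewrite -prod_nat_const; apply: leq_prod => w wW; rewrite /D wW.
  exact: ball_half cW wW s2 noS.
have fD v : v \in reach s W -> f v \in family D.
  move=> vR; apply/familyP=> w; rewrite /D ffunE; case: ifP => wW; last by rewrite inE.
  by have /andP[] := midP v w vR wW.
(* Pigeonhole: if every fibre of [f] had fewer than [k] vertices, then [reach s W] would have at
   most [(k ^ 2) ^ #|W| * k] vertices, against [large]. *)
have [m kF] : exists m, k <= #|[set v in reach s W | f v == m]|.
  apply/existsP; apply: contraLR large => /existsPn small; rewrite -leqNgt.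
  rewrite -sum1_card (partition_big f (mem (family D))) //=.
  apply: (@leq_trans (\sum_(m in family D) k)).
    apply: leq_sum => m _; have := small m; rewrite -ltnNge => /ltnW.
    by rewrite -sum1_card; under eq_bigl => v do rewrite inE.
  by rewrite sum_nat_const addn1 expnSr expnM leq_mul2r cD orbT.
have F0 : [set v in reach s W | f v == m] != set0.
  by rewrite -card_gt0; apply: leq_trans kF.
have fE v w : v \in [set v in reach s W | f v == m] -> w \in W ->
    v \in reach s W /\ m w = mid v w.
  by rewrite inE => /andP[vR /eqP<-] wW; rewrite ffunE wW.
have [S [WS FS dS]] : exists S,
    [/\ W \subset S, [set v in reach s W | f v == m] \subset S & diam_le S s].
  apply: (midpoint_club (m := m)) => // [w|w v] wW => [|vF].
    have /set0Pn[v vF] := F0; have [vR ->] := fE _ _ vF wW.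
    by have /andP[] := midP _ _ vR wW.
  by have [vR ->] := fE _ _ vF wW; have /andP[] := midP _ _ vR wW.
by exists S; split=> //; apply: leq_trans kF (subset_leq_card FS).
Qed.

End Graph.

(** * The reduced instance *)

Lemma dist_le_map (T T' : finType) (e : rel T) (e' : rel T') (h : T -> T') d u v :
  (forall x y, e x y -> e' (h x) (h y)) ->
  dist_le e d u v -> dist_le e' d (h u) (h v).
Proof.
move=> hom [p [ep lp sp]]; exists (map h p); split; rewrite ?size_map //.
  exact: homo_path ep.
by rewrite last_map lp.
Qed.

Section Restrict.
Context (G : graph) (R : {set 'I_(nv G)}).

(** Vertices of a [graph] are ordinals, so the subgraph induced by [R] has to be renumbered;
    [enum_val] translates back. *)
Definition restrict_adj : rel 'I_#|R| := fun i j => adj (enum_val i) (enum_val j).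

Lemma restrict_adj_sym : symmetric restrict_adj.
Proof. by move=> i j; apply: adj_sym. Qed.

Lemma restrict_adj_irrefl : irreflexive restrict_adj.
Proof. by move=> i; apply: adj_irrefl. Qed.

Definition restrict_graph := Graph restrict_adj_sym restrict_adj_irrefl.

Definition restrict_set (S : {set 'I_(nv G)}) : {set 'I_(nv restrict_graph)} :=
  [set i : 'I_#|R| | enum_val i \in S].

Lemma restrict_setK (S : {set _}) : S \subset R ->
  [set enum_val (i : 'I_#|R|) | i in restrict_set S] = S.
Proof.
move=> /subsetP SR; apply/setP=> v; apply/imsetP/idP => [[i + ->]|vS].
  by rewrite inE.
by exists (enum_rank_in (SR _ vS) v); rewrite ?inE enum_rankK_in // SR.
Qed.

Lemma card_restrict_set (S : {set _}) : S \subset R -> #|restrict_set S| = #|S|.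
Proof.
by move=> SR; rewrite -{2}(restrict_setK SR) card_imset //; apply: enum_val_inj.
Qed.

Lemma restrict_diam s (S : {set _}) : S \subset R ->
  diam_le S s -> diam_le (restrict_set S) s.
Proof.
move=> SR dS i j; rewrite !inE => iS jS.
(* [enum_rank_in] needs some element of [R] as a default, and [i] supplies one. *)
have g0 := enum_valP i.
rewrite -[i](enum_valK_in g0) -[j](enum_valK_in g0).
apply: dist_le_map (dS _ _ iS jS) => x y /and3P[xS yS xy].
rewrite /induced /= /restrict_adj !inE !enum_rankK_in ?(subsetP SR) //.
by rewrite xS yS.
Qed.

Lemma restrict_diam_imset s (S : {set 'I_(nv restrict_graph)}) :
  diam_le S s -> diam_le [set enum_val (i : 'I_#|R|) | i in S] s.
Proof.
move=> dS _ _ /imsetP[i iS ->] /imsetP[j jS ->].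
apply: dist_le_map (dS _ _ iS jS) => x y /and3P[xS yS xy].
by rewrite /induced /= !imset_f.
Qed.

End Restrict.

Definition restrict (I : instance) (R : {set 'I_(nv (gr I))}) : instance :=
  Instance (restrict_set R (seeds I)) (par I).

Definition edge_adj : rel 'I_2 := fun i j => i != j.

Lemma edge_adj_sym : symmetric edge_adj.
Proof. by move=> i j; rewrite /edge_adj eq_sym. Qed.

Lemma edge_adj_irrefl : irreflexive edge_adj.
Proof. by move=> i; rewrite /edge_adj eqxx. Qed.

Definition edge_graph := Graph edge_adj_sym edge_adj_irrefl.

(** A fixed yes-instance within the restricted class: one endpoint of an edge is the seed, and
    [k = 2] is the least value above the number of seeds. *)
Definition edge_instance : instance :=
  @Instance edge_graph [set (ord0 : 'I_2)] 2.

Lemma edge_instance_clique : clique_instance edge_instance.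
Proof.
split; rewrite /= ?cards1 //; first by apply/set0Pn; exists ord0; rewrite inE.
Qed.

Lemma edge_instance_club s : 1 < s -> seeded_club s edge_instance.
Proof.
move=> s2; exists [set: 'I_2]; split=> /=; rewrite ?subsetT ?cardsT ?card_ord //.
move=> u v _ _; have [->|uv] := eqVneq u v; first exact: dist_le_refl.
by apply: dist_le_edge; [lia | rewrite /induced /= !inE].
Qed.

Definition kernelize s (I : instance) : instance :=
  if par I ^ (2 * #|seeds I| + 1) < #|reach s (seeds I)| then edge_instance
  else restrict (reach s (seeds I)).

Lemma seeds_reach s I : 1 < s -> clique (seeds I) ->
  seeds I \subset reach s (seeds I).
Proof.
move=> s2 cW; apply/subsetP=> w wW; rewrite inE; apply/forall_inP=> w' w'W.
by apply/(subsetP (clique_ball cW w'W _)) => //; lia.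
Qed.

Lemma kernelize_clique s I : 1 < s -> clique_instance I ->
  clique_instance (kernelize s I).
Proof.
move=> s2 [k0 W0 Wk cW]; rewrite /kernelize; case: ifP => _.
  exact: edge_instance_clique.
have WR := seeds_reach s2 cW.
have cE : #|restrict_set (reach s (seeds I)) (seeds I)| = #|seeds I|.
  exact: card_restrict_set.
split=> //=; rewrite ?cE //.
  by rewrite -card_gt0 cE card_gt0.
move=> i j; rewrite !inE => iW jW ij; apply: cW => //.
by apply: contra_neq ij; apply: enum_val_inj.
Qed.

Lemma kernelize_club s I : 1 < s -> clique_instance I ->
  seeded_club s I <-> seeded_club s (kernelize s I).
Proof.
move=> s2 [k0 W0 Wk cW]; rewrite /kernelize; case: ltnP => [large|_].
  split=> _; first exact: edge_instance_club.
  exact: large_reach_club large.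
have WR := seeds_reach s2 cW.
split=> [[S [WS kS dS]]|[S [WS kS dS]]].
  have SR := club_reach WS dS.
  exists (restrict_set _ S); split; rewrite ?card_restrict_set //.
    by apply/subsetP=> i; rewrite !inE; apply: (subsetP WS).
  exact: restrict_diam.
exists [set enum_val (i : 'I_#|reach s (seeds I)|) | i in S]; split.
- rewrite -{1}(restrict_setK WR); exact: imsetS.
- by rewrite card_imset //; apply: enum_val_inj.
- exact: restrict_diam_imset.
Qed.

(** The factor 2 pays for the two vertices of [edge_instance]; the power is at least 1 because [k]
    is positive. *)
Lemma kernelize_size s I : clique_instance I ->
  nv (gr (kernelize s I)) <= 2 * par I ^ (2 * #|seeds I| + 1).
Proof.
move=> [k0 _ _ _]; rewrite /kernelize; case: ltnP => [_|le] /=.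
  by rewrite leq_pmulr // expn_gt0 k0.
by apply: leq_trans le _; rewrite leq_pmull.
Qed.

(** A kernel must be bounded in [k] alone; [#|W| < k] removes the seeds from the exponent, and the
    summand 2 covers the parameter of [edge_instance]. *)
Lemma kernelize_bound s I : clique_instance I ->
  nv (gr (kernelize s I)) + par (kernelize s I)
    <= 2 * par I ^ (2 * par I + 1) + (par I + 2).
Proof.
move=> cI; have [k0 _ Wk _] := cI; apply: leq_add.
  apply: leq_trans (kernelize_size _ cI) _; rewrite leq_mul2l /=.
  by apply: leq_pexp2l => //; rewrite leq_add2r leq_mul2l ltnW.
by rewrite /kernelize; case: ifP => _ /=; lia.
Qed.

(** * Verification of programs with time bounds *)

Fixpoint mods (c : cmd) : seq nat :=
  match c with
  | Skip => [::]
  | Put a _ _ => [:: a]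
  | Then c1 c2 => mods c1 ++ mods c2
  | If _ c1 c2 => mods c1 ++ mods c2
  | While _ c => mods c
  end.

Definition agree (M : seq nat) (st st' : store) :=
  forall a, a \notin M -> st' a =1 st a.

Lemma agree_refl M st : agree M st st.
Proof. by []. Qed.

Lemma agree_trans M st1 st2 st3 :
  agree M st1 st2 -> agree M st2 st3 -> agree M st1 st3.
Proof. by move=> h1 h2 a aM i; rewrite h2 // h1. Qed.

Lemma agree_sub M M' st st' : {subset M <= M'} -> agree M st st' -> agree M' st st'.
Proof. by move=> sub h a aM; apply: h; apply: contra aM => /sub. Qed.

Lemma update_same st a i x : update st a i x a i = x.
Proof. by rewrite /update !eqxx. Qed.

Lemma update_other st a i x j : j != i -> update st a i x a j = st a j.
Proof. by rewrite /update eqxx => /negbTE->. Qed.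

Lemma agree_update M st a i x : a \in M -> agree M st (update st a i x).
Proof. by move=> aM b bM j; rewrite /update; case: eqP bM => // ->; rewrite aM. Qed.

Lemma exec_agree c st st' t : exec c st st' t -> agree (mods c) st st'.
Proof.
elim=> {c st st' t} /=.
- by move=> st; apply: agree_refl.
- by move=> a i e st; apply: agree_update; rewrite inE.
- move=> c1 c2 st1 st2 st3 t1 t2 _ h1 _ h2; apply: (@agree_trans _ _ st2).
    by apply: agree_sub h1 => x; rewrite mem_cat => ->.
  by apply: agree_sub h2 => x; rewrite mem_cat orbC => ->.
- move=> e c1 c2 st st' t _ _; apply: agree_sub => x.
  by rewrite mem_cat => ->.
- move=> e c1 c2 st st' t _ _; apply: agree_sub => x.
  by rewrite mem_cat orbC => ->.
- by move=> e c st _; apply: agree_refl.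
- move=> e c st1 st2 st3 t1 t2 _ _ h1 _ h2; exact: agree_trans h1 h2.
Qed.

(** Total correctness within a time budget. As [T] is only an upper bound, branches of different
    cost can share one budget. *)
Definition wp (c : cmd) (T : nat) (Q : store -> Prop) (st : store) : Prop :=
  exists st' t, [/\ exec c st st' t, t <= T & Q st'].

(** The frame condition is supplied for free: the new postcondition is only needed on stores that
    agree with [st] outside the arrays that [c] may write. *)
Lemma wp_weaken c T T' (Q Q' : store -> Prop) st :
  T <= T' -> (forall st', agree (mods c) st st' -> Q st' -> Q' st') ->
  wp c T Q st -> wp c T' Q' st.
Proof.
move=> TT QQ [st' [t [ex tT q]]]; exists st', t; split=> //.
  exact: leq_trans TT.
exact: QQ (exec_agree ex) q.
Qed.

Lemma wp_skip (Q : store -> Prop) st : Q st -> wp Skip 1 Q st.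
Proof. by move=> q; exists st, 1; split=> //; apply: ExecSkip. Qed.

Lemma wp_put a i e (Q : store -> Prop) st :
  Q (update st a (eval st i) (eval st e)) -> wp (Put a i e) 1 Q st.
Proof. by move=> q; eexists _, 1; split=> //; first exact: ExecPut. Qed.

Lemma wp_then c1 c2 T1 T2 (Q1 Q : store -> Prop) st :
  wp c1 T1 Q1 st ->
  (forall st', agree (mods c1) st st' -> Q1 st' -> wp c2 T2 Q st') ->
  wp (Then c1 c2) (T1 + T2) Q st.
Proof.
move=> [st1 [t1 [ex1 le1 q1]]] /(_ _ (exec_agree ex1) q1) [st2 [t2 [ex2 le2 q2]]].
by exists st2, (t1 + t2); split; rewrite ?leq_add //; apply: ExecThen ex1 ex2.
Qed.

Lemma wp_if e c1 c2 T (Q : store -> Prop) st :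
  (eval st e != 0 -> wp c1 T Q st) -> (eval st e = 0 -> wp c2 T Q st) ->
  wp (If e c1 c2) T.+1 Q st.
Proof.
have [e0|e0] := eqVneq (eval st e) 0.
  move=> _ /(_ e0) [st' [t [ex le q]]]; exists st', t.+1; split=> //.
  exact: ExecIfFalse.
move=> /(_ isT) [st' [t [ex le q]]] _; exists st', t.+1; split=> //.
exact: ExecIfTrue.
Qed.

(** * Loops, bounded search and table filling *)

Local Notation Var a := (Get a (Lit 0)).
Local Notation Assign a e := (Put a (Lit 0) e).

Definition For (i b : nat) (c : cmd) : cmd :=
  Then (Assign i (Lit 0))
    (While (Minus (Var b) (Var i)) (Then c (Assign i (Plus (Var i) (Lit 1))))).

(** Each round pays one step for the test and one for the increment; the initial assignment and the
    failing last test give the final 2. The invariant must ignore the counter array, since the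
    increment follows the body. *)
Lemma wp_for i b c n T (Q : nat -> store -> Prop) st :
  i \notin mods c -> b \notin i :: mods c -> st b 0 = n ->
  (forall j st1 st2, agree [:: i] st1 st2 -> Q j st1 -> Q j st2) ->
  Q 0 st ->
  (forall j st', j < n -> agree (i :: mods c) st st' -> st' i 0 = j -> Q j st' ->
     wp c T (Q j.+1) st') ->
  wp (For i b c) (n * (T + 2) + 2) (Q n) st.
Proof.
move=> ic bc bn Qi Q0 step.
(* Induction on the number [m] of rounds still to run. *)
have loop m : forall j st', j + m = n -> agree (i :: mods c) st st' ->
    st' i 0 = j -> Q j st' ->
    wp (While (Minus (Var b) (Var i)) (Then c (Assign i (Plus (Var i) (Lit 1)))))
       (m * (T + 2) + 1) (Q n) st'.
  elim: m => [|m IH] j st' jm ag ij Qj.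
    exists st', 1; split=> //; last by rewrite -jm addn0.
    by apply: ExecWhileDone; rewrite /= ag // bn ij; lia.
  have [st1 [t1 [ex1 le1 q1]]] : wp c T (Q j.+1) st' by apply: step => //; lia.
  have i1 : st1 i 0 = j by rewrite (exec_agree ex1).
  pose st2 := update st1 i 0 (j + 1).
  have [||||st3 [t3 [ex3 le3 q3]]] := IH j.+1 st2; rewrite /st2 ?addSnnS //.
  - apply: (@agree_trans _ _ st1); last by apply: agree_update; rewrite inE eqxx.
    apply: agree_trans ag _; apply: agree_sub (exec_agree ex1) => x xc.
    by rewrite inE xc orbT.
  - by rewrite update_same addn1.
  - by apply: Qi q1; apply: agree_update; rewrite inE.
  exists st3, (t1 + 1 + t3).+1; split=> //; last by lia.
  apply: ExecWhileStep ex3; first by rewrite /= ag // bn ij; lia.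
  apply: ExecThen ex1 _.
  rewrite /st2; have -> : j + 1 = eval st1 (Plus (Var i) (Lit 1)) by rewrite /= i1.
  exact: ExecPut.
rewrite addnC -[2]/(1 + 1) -addnA [X in 1 + X]addnC.
apply: (@wp_then _ _ _ _
  (fun st' => [/\ agree (i :: mods c) st st', st' i 0 = 0 & Q 0 st'])).
  apply: wp_put; split; first by apply: agree_update; rewrite inE eqxx.
    exact: update_same.
  by apply: Qi Q0; apply: agree_update; rewrite inE.
by move=> st' _ [ag i0 q]; apply: (loop n 0).
Qed.

Definition Any (x b : nat) (e : expr) (r : nat) : cmd :=
  Then (Assign r (Lit 0)) (For x b (If e (Assign r (Lit 1)) Skip)).

(** The flag is only ever raised, so after [j] rounds it tells whether a witness below [j] exists. A
    round costs 2 for the conditional and 2 for the loop. *)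
Lemma wp_any x b e r n (p : pred 'I_n) st :
  x != r -> b \notin [:: x; r] -> st b 0 = n ->
  (forall (j : 'I_n) st', agree [:: x; r] st st' -> st' x 0 = j ->
     (eval st' e != 0) = p j) ->
  wp (Any x b e r) (4 * n + 3) (fun st' => st' r 0 = [exists j, p j]) st.
Proof.
move=> xr bxr bn ep.
have -> : 4 * n + 3 = 1 + (n * (2 + 2) + 2) by lia.
apply: (@wp_then _ _ _ _ (fun st' => st' r 0 = 0)).
  by apply: wp_put; apply: update_same.
move=> st1 ag1 r1.
have ag1' : agree [:: x; r] st st1.
  by apply: agree_sub ag1 => y; rewrite !inE => ->; rewrite orbT.
pose Q j (st' : store) := st' r 0 = [exists y : 'I_n, (y < j) && p y].
apply: wp_weaken (leqnn _) _ (_ : wp _ _ (Q n) _) => [st' _ ->|].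
  by congr nat_of_bool; apply: eq_existsb => y; rewrite ltn_ord.
apply: wp_for => //=.
- by rewrite inE.
- by rewrite ag1'.
- by move=> j st2 st3 ag q; rewrite /Q ag // inE eq_sym.
- by rewrite /Q r1; case: existsP => // -[y].
move=> j st' jn ag xj q.
have ag' : agree [:: x; r] st st'.
  by apply: agree_trans ag1' _; apply: agree_sub ag => y.
have Qn (st2 : store) : st2 r 0 = (st' r 0 != 0) || p (Ordinal jn) -> Q j.+1 st2.
  rewrite /Q => ->; rewrite q -lt0n lt0b; congr nat_of_bool.
  apply/orP/existsP => [[/existsP[y /andP[yj py]]|pj]|[y /andP[yj py]]].
  - by exists y; rewrite py ltnS ltnW.
  - by exists (Ordinal jn); rewrite pj ltnSn.
  move: yj; rewrite ltnS leq_eqVlt => /orP[/eqP yj|yj].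
    by right; rewrite (_ : Ordinal jn = y) //; apply: val_inj.
  by left; apply/existsP; exists y; rewrite yj.
have E := ep (Ordinal jn) _ ag' xj.
apply: wp_if => e0.
  by apply: wp_put; apply: Qn; rewrite -E e0 orbT /= update_same.
apply: wp_skip; apply: Qn; rewrite -E e0 orbF q.
by case: [exists _, _].
Qed.

Lemma index_inj n u v u' v' :
  v < n -> v' < n -> u * n + v = u' * n + v' -> u = u' /\ v = v'.
Proof.
move=> vn vn' E; have n0 : 0 < n by lia.
split; first by move/(congr1 (divn^~ n)): E; rewrite !divnMDl // !divn_small // !addn0.
by move/(congr1 (modn^~ n)): E; rewrite !modnMDl !modn_small.
Qed.

Definition Fill (v b A : nat) (ie : expr) (c : cmd) (e : expr) : cmd :=
  For v b (Then c (Put A ie e)).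

Definition fill_time n T := n * (T + 1 + 2) + 2.

(** Injectivity of the address map [h] protects earlier entries from later writes. The clause on
    untouched cells lets [wp_mat] keep the rows filled before. *)
Lemma wp_fill v b A ie c e n T (h : nat -> nat) (F : 'I_n -> nat) st :
  let M := v :: mods c in
  v \notin A :: mods c -> b \notin A :: M -> A \notin M -> st b 0 = n ->
  {in [pred j | j < n] &, injective h} ->
  (forall (j : 'I_n) st', agree (A :: M) st st' -> st' v 0 = j ->
     wp c T (fun st'' => eval st'' ie = h j /\ eval st'' e = F j) st') ->
  wp (Fill v b A ie c e) (fill_time n T)
    (fun st' => (forall j : 'I_n, st' A (h j) = F j) /\
       forall x, (forall j, j < n -> x != h j) -> st' A x = st A x) st.
Proof.
rewrite /fill_time /= => vA bA AM bn hinj step.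
have memE : mods c ++ [:: A] =i A :: mods c.
  by move=> x; rewrite mem_cat !inE orbC.
pose Q j (st' : store) := (forall l : 'I_n, l < j -> st' A (h l) = F l) /\
       forall x, (forall l, l < j -> x != h l) -> st' A x = st A x.
apply: wp_weaken (leqnn _) _ (_ : wp _ _ (Q n) _) => [st' _ [q1 q2]|].
  by split=> // j; apply: q1.
have Av : A != v by move: AM; rewrite inE negb_or => /andP[].
apply: wp_for => //=.
- by rewrite memE.
- by rewrite !inE memE inE orbCA; move: bA; rewrite !inE.
- move=> j st1 st2 ag [q1 q2]; split=> [l lj|x xl]; rewrite ag ?inE //.
    exact: q1.
  exact: q2.
move=> j st' jn ag vj [q1 q2].
have ag' : agree [:: A, v & mods c] st st'.
  by apply: agree_sub ag => x; rewrite inE memE !inE orbCA.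
apply: (@wp_then _ _ _ _ _ _ _ (step (Ordinal jn) st' ag' vj)) => st1 ag1 [ieE eE].
apply: wp_put; rewrite ieE eE.
have A1 x : st1 A x = st' A x.
  by apply: ag1; move: AM; rewrite inE negb_or => /andP[].
split=> [l|x xl].
  rewrite ltnS leq_eqVlt => /orP[/eqP lj|lj].
    rewrite -[X in h X]lj update_same; congr F; exact/val_inj/esym.
  rewrite update_other ?A1 ?q1 //; apply/negP=> /eqP/hinj; rewrite !inE => E.
  by move: lj; rewrite E ?ltnn //=.
rewrite update_other ?xl //= A1 q2 // => l lj.
by apply: xl; rewrite ltnS ltnW.
Qed.

Definition Vec b A c e := Fill 5 b A (Var 5) c e.

Lemma wp_vec b A c e n T (F : 'I_n -> nat) st :
  5 \notin A :: mods c -> b \notin [:: A, 5 & mods c] -> A \notin 5 :: mods c ->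
  st b 0 = n ->
  (forall (j : 'I_n) st', agree [:: A, 5 & mods c] st st' -> st' 5 0 = j ->
     wp c T (fun st'' => eval st'' e = F j) st') ->
  wp (Vec b A c e) (fill_time n T) (fun st' => forall j : 'I_n, st' A j = F j) st.
Proof.
move=> c5 bA A5 bn step.
apply: wp_weaken (leqnn _) _ (wp_fill (h := id) (F := F) _ _ _ bn _ _) => //.
  by move=> st' _ [].
move=> j st' ag vj; apply: wp_weaken (leqnn _) _ (step j st' ag vj) => st2 ag2 ->.
by split=> //=; rewrite ag2 //; move: c5; rewrite inE negb_or => /andP[].
Qed.

Definition Mat b rows A c e :=
  For 4 b (Fill 5 b A (Plus (Get rows (Var 4)) (Var 5)) c e).

Definition mat_time n T := n * (fill_time n T + 2) + 2.

(** By [index_inj] distinct rows occupy disjoint cells, so filling row [j] preserves all rows below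
    it. *)
Lemma wp_mat b rows A c e n T (F : 'I_n -> 'I_n -> nat) st :
  let M := [:: 4, 5 & mods c] in
  4 \notin [:: A, 5 & mods c] -> 5 \notin A :: mods c -> A \notin M ->
  b \notin A :: M -> rows \notin A :: M ->
  st b 0 = n -> (forall u : 'I_n, st rows u = u * n) ->
  (forall (u v : 'I_n) st', agree (A :: M) st st' -> st' 4 0 = u -> st' 5 0 = v ->
     wp c T (fun st'' => eval st'' e = F u v) st') ->
  wp (Mat b rows A c e) (mat_time n T)
    (fun st' => forall u v : 'I_n, st' A (u * n + v) = F u v) st.
Proof.
rewrite /mat_time /= => c4 c5 AM bA rA bn rE step.
pose Q j (st' : store) := forall u v : 'I_n, u < j -> st' A (u * n + v) = F u v.
apply: wp_weaken (leqnn _) _ (_ : wp _ _ (Q n) _) => [st' _ q u v|]; first exact: q.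
have memE : 5 :: (mods c ++ [:: A]) ++ [:: 5] =i [:: A, 5 & mods c].
  by move=> x; rewrite !(inE, mem_cat); case: (x == 5); case: (x == A); case: (x \in _).
apply: wp_for => //=.
- by rewrite memE.
- by move: bA; rewrite [in X in _ -> X]inE memE !inE; case: (b == 4); case: (b == A).
- move=> j st1 st2 ag q u v uj; rewrite ag ?q //.
  by move: AM; rewrite !inE; case: (A == 4).
move=> j st' jn ag j4 q.
have ag' : agree [:: A, 4, 5 & mods c] st st'.
  apply: agree_sub ag => x; rewrite inE memE !inE.
  by case: (x == 4); case: (x == A).
apply: wp_weaken (leqnn _) _ (wp_fill (h := fun v => j * n + v)
  (F := F (Ordinal jn)) _ _ _ (n := n) _ _ _) => /=.
- move=> st2 _ [q1 q2] u v; rewrite ltnS leq_eqVlt => /orP[/eqP uj|uj].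
    by rewrite uj q1; congr F; apply/val_inj.
  rewrite q2 ?q // => l ln; apply/eqP=> /index_inj[] // E.
  by move: uj; rewrite E ltnn.
- by [].
- by move: bA; rewrite !inE; case: (b == 4); case: (b == A).
- by move: AM; rewrite !inE; case: (A == 4).
- by rewrite ag'.
- by move=> v v' vn vn' /index_inj[].
move=> v st1 ag1 v5.
have ag1' : agree [:: A, 4, 5 & mods c] st st1.
  apply: agree_trans ag' _; apply: agree_sub ag1 => x; rewrite !inE.
  by case: (x == 4); case: (x == A).
have j4' : st1 4 0 = j by rewrite ag1.
apply: wp_weaken (leqnn _) _ (step (Ordinal jn) v st1 ag1' j4' v5) => st2 ag2 ->.
split=> //=.
have -> : st2 4 0 = j.
  by rewrite ag2 //; move: c4; rewrite !inE !negb_or => /and3P[].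
have -> : st2 5 0 = v by rewrite ag2 //; move: c5; rewrite inE negb_or => /andP[].
rewrite ag2 ?ag1' ?(rE (Ordinal jn)) //.
by move: rA; rewrite !inE !negb_or => /and4P[].
Qed.

(** Multiples of the row length are obtained as running sums. *)
Definition Rows b A :=
  Then (Assign A (Lit 0))
    (For 4 b (Put A (Plus (Var 4) (Lit 1)) (Plus (Get A (Var 4)) (Var b)))).

Lemma wp_rows b A n st : 4 != A -> b \notin [:: 4; A] -> st b 0 = n ->
  wp (Rows b A) (3 * n + 3) (fun st' => forall u : 'I_n, st' A u = u * n) st.
Proof.
move=> A4 bA bn; have -> : 3 * n + 3 = 1 + (n * (1 + 2) + 2) by lia.
pose Q j (st' : store) := forall x, x <= j -> st' A x = x * n.
apply: (@wp_then _ _ _ _ (Q 0)).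
  by apply: wp_put => x; rewrite leqn0 => /eqP->; rewrite update_same.
move=> st1 ag1 q1.
have bn1 : st1 b 0 = n.
  by rewrite ag1 //; move: bA; rewrite /= !inE negb_or => /andP[].
apply: wp_weaken (leqnn _) _ (_ : wp _ _ (Q n) _) => [st' _ q u|].
  exact/q/ltnW.
apply: wp_for => //=.
- by rewrite inE.
- by move=> j st2 st3 ag q x xj; rewrite ag ?q // inE eq_sym.
move=> j st' jn ag j4 q; apply: wp_put => x xj.
rewrite /= j4 (ag b) // bn1 q // addn1.
move: xj; rewrite leq_eqVlt => /orP[/eqP->|xj].
  by rewrite update_same mulSn addnC.
by rewrite update_other ?q // neq_ltn xj.
Qed.

(** * The kernelization program *)

(** The content of [holds], indexed by vertices instead of list positions, as the table-filling
    rules need it. *)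
Definition represents (st : store) (I : instance) : Prop :=
  [/\ st 0 0 = nv (gr I), st 1 0 = par I,
      forall v : 'I_(nv (gr I)), st 2 v = (v \in seeds I) &
      forall u v : 'I_(nv (gr I)), st 3 (u * nv (gr I) + v) = adj u v].

(* Arrays 0 to 3 hold the input, and 15 and 16 copies of the seeds and of the
   adjacency matrix, so that the output can overwrite 2 and 3. Cell [u] of
   array 8 is [u * n] (18: the same for the output), as the machine has no
   multiplication. Array [20 + i] is the matrix of distances at most [i].
   Array 9 marks the vertices kept, 10 lists them and 11 is their number.
   12 is the threshold [k ^ (2 * #|W| + 1)], capped at 17, that is [n + 1].
   4 to 7, 13 and 14 are counters and temporaries. *)
Definition ready (st : store) (I : instance) : Prop :=
  [/\ st 0 0 = nv (gr I), st 1 0 = par I,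
      forall u : 'I_(nv (gr I)), st 8 u = u * nv (gr I),
      forall v : 'I_(nv (gr I)), st 15 v = (v \in seeds I) &
      forall u v : 'I_(nv (gr I)), st 16 (u * nv (gr I) + v) = adj u v].

Lemma ready_agree M st st' I :
  all [pred a | a \notin [:: 0; 1; 8; 15; 16]] M -> agree M st st' ->
  ready st I -> ready st' I.
Proof.
move=> /allP MP ag [i0 i1 i8 i15 i16].
have E a : a \in [:: 0; 1; 8; 15; 16] -> st' a =1 st a.
  by move=> aP; apply: ag; apply/negP=> /MP; rewrite /= aP.
by split=> *; rewrite E.
Qed.

Definition prepare : cmd :=
  Then (Rows 0 8)
    (Then (Vec 0 15 Skip (Get 2 (Var 5)))
          (Mat 0 8 16 Skip (Get 3 (Plus (Get 8 (Var 4)) (Var 5))))).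

Lemma wp_prepare st I (n := nv (gr I)) : represents st I ->
  wp prepare (3 * n + 3 + (fill_time n 1 + mat_time n 1)) (ready^~ I) st.
Proof.
move=> [i0 i1 i2 i3].
apply: (wp_then (wp_rows (n := n) _ _ _)) => // st1 ag1 q1.
apply: (wp_then (wp_vec (T := 1) (n := n) (F := fun v => v \in seeds I) _ _ _ _ _)) => //.
- by rewrite ag1.
- move=> j st2 ag2 j5; apply: wp_skip.
  by rewrite /= j5 ag2 // ag1.
move=> st2 ag2 q2.
apply: wp_weaken (leqnn _) _
  (wp_mat (T := 1) (n := n) (F := fun u v => adj u v) _ _ _ _ _ _ _ _) => //.
- move=> st3 ag3 q3; split=> // *.
  + by rewrite ag3 // ag2 // ag1.
  + by rewrite ag3 // ag2 // ag1.
  + by rewrite ag3 // ag2 // q1.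
  + by rewrite ag3 // q2.
- by rewrite ag2 // ag1.
- by move=> u; rewrite ag2.
move=> u v st3 ag3 u4 v5; apply: wp_skip => /=.
by rewrite u4 v5 ag3 // [st3 8 u]ag3 // ag2 // [st2 8 u]ag2 // q1 ag1 // i3.
Qed.

(** * Computing distances and the vertices to keep *)

Definition EqE (e1 e2 : expr) : expr :=
  Minus (Lit 1) (Plus (Minus e1 e2) (Minus e2 e1)).

Lemma eval_EqE st e1 e2 : eval st (EqE e1 e2) = (eval st e1 == eval st e2).
Proof. by rewrite /=; case: eqP => /= [->|]; lia. Qed.

(** For bits, a sum minus 1 is a conjunction: [x] is in the previous ball, and [x] equals or is
    adjacent to the target. The inner sum plays the part of the disjunction. *)
Fixpoint balls (s : nat) : cmd :=
  if s is i.+1 then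
    Then (balls i)
      (Mat 0 8 (20 + i.+1)
         (Any 6 0
            (Minus (Plus (Get (20 + i) (Plus (Get 8 (Var 4)) (Var 6)))
                         (Plus (Get 16 (Plus (Get 8 (Var 6)) (Var 5)))
                               (EqE (Var 6) (Var 5))))
                   (Lit 1))
            7)
         (Var 7))
  else Mat 0 8 20 Skip (EqE (Var 4) (Var 5)).

Lemma balls_mods s : all [pred a | a \notin [:: 0; 1; 8; 15; 16]] (mods (balls s)).
Proof. by elim: s => [//|s IH] /=; rewrite all_cat IH. Qed.

Definition balls_time (s n : nat) : nat :=
  mat_time n 1 + s * mat_time n (4 * n + 3).

Lemma wp_balls s st I (n := nv (gr I)) : ready st I ->
  wp (balls s) (balls_time s n)
    (fun st' => forall u v : 'I_n,
       st' (20 + s) (u * n + v) = (v \in ball (@adj (gr I)) s u)) st.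
Proof.
move=> rd; elim: s => [|s IH].
  have [i0 _ i8 _ _] := rd.
  rewrite /balls_time mul0n addn0.
  apply: (wp_mat (T := 1) (F := fun u v => v \in ball (@adj (gr I)) 0 u)) => //.
  move=> u v st' ag u4 v5; apply: wp_skip.
  by rewrite eval_EqE [eval _ _]/= u4 [eval _ _]/= v5 inE eq_sym.
rewrite /balls_time mulSn [X in _ + X]addnC addnA.
apply: (wp_then IH) => st1 ag1 q1.
have rd1 := ready_agree (balls_mods s) ag1 rd.
have [i0 _ i8 _ i16] := rd1.
apply: (wp_mat (T := 4 * n + 3) (F := fun u v => v \in ball (@adj (gr I)) s.+1 u)) => //.
move=> u v st2 ag2 u4 v5.
pose p (x : 'I_n) := (x \in ball (@adj (gr I)) s u) && ((x == v) || adj x v).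
have Eb : (v \in ball (@adj (gr I)) s.+1 u) = [exists x, p x] by rewrite inE.
apply: wp_weaken (leqnn _) _ (wp_any (n := n) (p := p) _ _ _ _) => //.
- by move=> st3 _ /= ->; rewrite -Eb.
- by rewrite ag2.
move=> x st3 ag3 x6.
have ag : agree [:: 20 + s.+1; 4; 5; 6; 7; 6] st1 st3.
  apply: agree_trans (agree_sub _ ag2) (agree_sub _ ag3) => y; rewrite !inE.
    by do ?case: eqP.
  by do ?case: eqP.
have n20 : 20 + s \notin [:: 20 + s.+1; 4; 5; 6; 7; 6] by rewrite !inE; lia.
have E4 : st3 4 0 = u by rewrite ag3.
have E5 : st3 5 0 = v by rewrite ag3.
have Eeq := eval_EqE st3 (Var 6) (Var 5).
rewrite /= in Eeq; rewrite /= Eeq E4 E5 x6.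
rewrite !(ag 8) // !i8 (ag 16) // i16 (ag _ n20) q1 /p.
(* Irreflexivity prevents adjacency and equality from both contributing 1, which would make the test
   succeed outside the ball. *)
have [->|xv] := eqVneq x v; first by rewrite adj_irrefl eqxx; case: (_ \in _).
have -> : (val x == val v) = false by apply/negbTE.
by case: (_ \in _); case: (adj x v).
Qed.

(** The universal condition is computed as the negation of a search for a seed that is too far away;
    truncated subtraction of bits expresses [and not]. *)
Definition mark_reach (s : nat) : cmd :=
  Vec 0 9
    (Any 6 0 (Minus (Get 15 (Var 6)) (Get (20 + s) (Plus (Get 8 (Var 6)) (Var 5)))) 7)
    (Minus (Lit 1) (Var 7)).

Lemma wp_mark_reach s st I (n := nv (gr I)) : ready st I ->
  (forall u v : 'I_n, st (20 + s) (u * n + v) = (v \in ball (@adj (gr I)) s u)) ->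
  wp (mark_reach s) (fill_time n (4 * n + 3))
    (fun st' => forall v : 'I_n, st' 9 v = (v \in reach s (seeds I))) st.
Proof.
move=> [i0 _ i8 i15 _] q.
apply: (wp_vec (n := n) (F := fun v => v \in reach s (seeds I))) => //.
move=> v st2 ag2 v5.
pose p (w : 'I_n) := (w \in seeds I) && (v \notin ball (@adj (gr I)) s w).
apply: wp_weaken (leqnn _) _ (wp_any (n := n) (p := p) _ _ _ _) => //.
- move=> st3 _ /= ->; rewrite inE.
  have -> : [forall w in seeds I, v \in ball (@adj (gr I)) s w] = ~~ [exists w, p w].
    rewrite negb_exists; apply: eq_forallb => w; rewrite /p negb_and negbK.
    by rewrite implybE.
  by case: [exists w, p w].
- by rewrite ag2.
move=> w st3 ag3 w6.
have ag : agree [:: 9; 5; 7; 6] st st3.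
  apply: agree_trans (agree_sub _ ag2) (agree_sub _ ag3) => y; rewrite !inE.
    by do ?case: eqP.
  by do ?case: eqP.
have n20 : 20 + s \notin [:: 9; 5; 7; 6] by rewrite !inE; lia.
rewrite [eval _ _]/= w6 (ag3 5) // v5 (ag 8) // i8 (ag 15) // i15 (ag _ n20) q /p.
by case: (_ \in _); case: (_ \in _).
Qed.

Definition collect : cmd :=
  Then (Assign 11 (Lit 0))
    (For 5 0
      (If (Get 9 (Var 5))
         (Then (Put 10 (Var 11) (Var 5)) (Assign 11 (Plus (Var 11) (Lit 1))))
         Skip)).

Lemma filter_iota_enum n (R : {set 'I_n}) (q : pred nat) :
  (forall v : 'I_n, q v = (v \in R)) -> [seq x <- iota 0 n | q x] = map val (enum R).
Proof.
move=> qR; rewrite -val_enum_ord filter_map; congr map.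
by rewrite [in RHS]/enum_mem -enumT; apply: eq_filter => v; rewrite /= qR.
Qed.

(** The vertices are listed in increasing order, which is the order of [enum]; thus the program
    renumbers them exactly as [restrict] does. *)
Lemma wp_collect st n (R : {set 'I_n}) : st 0 0 = n ->
  (forall v : 'I_n, st 9 v = (v \in R)) ->
  wp collect (5 * n + 3)
    (fun st' => st' 11 0 = #|R| /\ forall i : 'I_#|R|, st' 10 i = enum_val i) st.
Proof.
move=> i0 i9; pose q x := st 9 x != 0.
pose L j := [seq x <- iota 0 j | q x].
pose Q j (st' : store) := st' 11 0 = size (L j) /\
  forall i, i < size (L j) -> st' 10 i = nth 0 (L j) i.
have LE : L n = map val (enum R).
  by apply: filter_iota_enum => v; rewrite /q i9; case: (_ \in _).
have -> : 5 * n + 3 = 1 + (n * (3 + 2) + 2) by lia.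
apply: (@wp_then _ _ _ _ (Q 0)); first by apply: wp_put; split=> //; rewrite update_same.
move=> st1 ag1 q1.
apply: wp_weaken (leqnn _) _ (_ : wp _ _ (Q n) _) => [st' _ [c10 c11]|].
  rewrite LE size_map -cardE in c10 c11; split=> // i.
  rewrite c11 // (nth_map (enum_val i)) -?cardE //.
  by rewrite /enum_val; congr val; apply: set_nth_default; rewrite -cardE.
apply: wp_for => //=; first by rewrite ag1.
  by move=> j st2 st3 ag [a b]; split=> [|i ij]; rewrite ag ?b.
move=> j st' jn ag j5 [a b].
have LS : L j.+1 = if q j then rcons (L j) j else L j.
  by rewrite /L -addn1 iotaD filter_cat /= add0n; case: (q j); rewrite ?cats1 ?cats0.
have E9 : st' 9 j = st 9 j by rewrite ag // ag1.
apply: wp_if; rewrite /= j5 E9 => qj.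
  apply: (@wp_then _ _ 1 1 (fun st2 => [/\ st2 11 0 = size (L j),
      forall i, i < size (L j) -> st2 10 i = nth 0 (L j) i & st2 10 (size (L j)) = j])).
    apply: wp_put; split=> [|i il|]; rewrite /= ?a ?j5 ?update_same //.
    by rewrite update_other ?b // neq_ltn il.
  move=> st2 _ [a2 b2 c2]; apply: wp_put; rewrite /Q LS /q qj size_rcons.
  split; first by rewrite update_same /= a2 addn1.
  move=> i; rewrite ltnS leq_eqVlt nth_rcons => /orP[/eqP->|il].
    by rewrite ltnn eqxx.
  by rewrite il -b2.
apply: wp_weaken (isT : 1 <= 2) _ (wp_skip (Q := Q j.+1) _) => //.
by rewrite /Q LS /q qj.
Qed.

(** * The capped threshold *)

Definition cap (e : expr) : expr := Minus (Var 17) (Minus (Var 17) e).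

Lemma eval_cap st e : eval st (cap e) = minn (st 17 0) (eval st e).
Proof. by rewrite /=; lia. Qed.

(** Multiplication by repeated addition. The loop is controlled by the capped value, at most
    [n + 1]; a loop over [k] could be exponential in the bit length of [k]. *)
Definition times_par : cmd :=
  Then (Assign 13 (Lit 0))
    (Then (For 14 12 (Assign 13 (Plus (Var 13) (Var 1))))
          (Assign 12 (cap (Var 13)))).

(** Since [k] is positive, a product whose factor has reached the cap stays at the cap, so capping
    after every multiplication loses nothing. *)
Lemma minn_minnM m x k : 0 < k -> minn m (minn m x * k) = minn m (x * k).
Proof. move=> k0; have [mx|//] := leqP m x.
have le y : m <= y -> m <= y * k by move=> my; apply: leq_trans my (leq_pmulr _ k0).
by rewrite !(minn_idPl _) ?le.
Qed.

Lemma wp_times_par st n k x : st 17 0 = n.+1 -> st 1 0 = k -> 0 < k ->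
  st 12 0 = minn n.+1 x ->
  wp times_par (3 * n + 7) (fun st' => st' 12 0 = minn n.+1 (x * k)) st.
Proof.
move=> i17 i1 k0 i12; have mn : minn n.+1 x <= n.+1 by lia.
apply: (@wp_weaken _ (1 + ((minn n.+1 x * (1 + 2) + 2) + 1)) _
  (fun st' => st' 12 0 = minn n.+1 (x * k))) => //; first by lia.
apply: (@wp_then _ _ _ _ (fun st' => st' 13 0 = 0)).
  by apply: wp_put; rewrite update_same.
move=> st1 ag1 q1.
apply: (@wp_then _ _ _ _ (fun st' => st' 13 0 = minn n.+1 x * k)).
  apply: (wp_for (Q := fun j st' => st' 13 0 = j * k)) => //.
  - by rewrite ag1.
  - by move=> j st2 st3 ag q; rewrite ag.
  move=> j st' jn ag _ q; apply: wp_put; rewrite update_same /= q ag // ag1 // i1.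
  by rewrite mulSn addnC.
move=> st2 ag2 q2; apply: wp_put; rewrite update_same eval_cap ag2 // ag1 // i17 /=.
by rewrite q2 minn_minnM.
Qed.

Definition threshold : cmd :=
  Then (Assign 17 (Plus (Var 0) (Lit 1)))
    (Then (Assign 12 (cap (Var 1)))
      (For 5 0 (If (Get 15 (Var 5)) (Then times_par times_par) Skip))).

Definition threshold_time n := 1 + (1 + (n * ((3 * n + 7 + (3 * n + 7)).+1 + 2) + 2)).

Lemma wp_threshold st I (n := nv (gr I)) : ready st I -> 0 < par I ->
  wp threshold (threshold_time n)
    (fun st' => st' 12 0 = minn n.+1 (par I ^ (2 * #|seeds I| + 1))) st.
Proof.
move=> [i0 i1 _ i15 _] k0.
(* [C j] counts the seeds among the first [j] vertices. The initial value [k] gives the 1 in the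
   exponent, and each seed contributes two more factors. *)
pose C j := #|[set w in seeds I | w < j]|.
pose Q j (st' : store) := st' 12 0 = minn n.+1 (par I ^ (2 * C j + 1)).
apply: (@wp_then _ _ _ _ (fun st' => st' 17 0 = n.+1)).
  by apply: wp_put; rewrite update_same /= i0 addn1.
move=> st1 ag1 q1.
apply: (@wp_then _ _ _ _ (Q 0)).
  apply: wp_put; rewrite /Q update_same eval_cap q1 /= ag1 // i1.
  by rewrite /C (eq_card0 (A := [set _ in _ | _])) => [|w];
    rewrite ?muln0 ?expn1 // !inE andbF.
move=> st2 ag2 q2.
have ag2' : agree [:: 12; 17] st st2.
  by apply: agree_trans (agree_sub _ ag1) (agree_sub _ ag2) => y;
    rewrite !inE => ->; rewrite ?orbT.
have C_n : C n = #|seeds I|.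
  by apply: eq_card => w; rewrite inE ltn_ord andbT.
apply: wp_weaken (leqnn _) _ (_ : wp _ _ (Q n) _) => [st' _|]; first by rewrite /Q C_n.
apply: wp_for => //=; first by rewrite ag2'.
  by move=> j st3 st4 ag q; rewrite /Q ag.
move=> j st' jn ag j5 q.
pose w := Ordinal jn.
have CS : C j.+1 = (w \in seeds I) + C j.
  rewrite /C (cardsD1 w) !inE ltnSn andbT; congr (_ + _).
  apply: eq_card => y; rewrite !inE ltnS [y <= j]leq_eqVlt -(inj_eq val_inj) /=.
  by case: (ltngtP y j); rewrite ?andbF.
have ag' : agree [:: 12; 17; 5; 13; 14] st st'.
  apply: agree_trans (agree_sub _ ag2') (agree_sub _ ag) => y; rewrite !inE.
    by do ?case: eqP.
  by do ?case: eqP.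
have E15 : st' 15 j = (w \in seeds I) by rewrite ag' // (i15 w).
have E1 : st' 1 0 = par I by rewrite ag'.
have E17 : st' 17 0 = n.+1 by rewrite ag // ag2.
apply: wp_if; rewrite /= j5 E15.
  rewrite eqb0 negbK => wW.
  apply: (wp_then (wp_times_par E17 E1 k0 q)) => st3 ag3 q3.
  apply: wp_weaken (leqnn _) _ (wp_times_par (n := n) (k := par I) _ _ _ q3);
    rewrite ?ag3 //.
  rewrite /Q => st4 _ ->; rewrite CS wW; congr minn.
  by rewrite add1n mulnS -[2 + _]addn2 addnAC addn2 !expnSr.
move/eqP; rewrite eqb0 => /negbTE wW.
apply: wp_weaken (_ : 1 <= _) _ (wp_skip (Q := Q j.+1) _) => //; first by lia.
by rewrite /Q CS wW.
Qed.

(** * Writing the output instance *)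

Definition emit_edge : cmd :=
  Then (Assign 0 (Lit 2)) (Then (Assign 1 (Lit 2))
 (Then (Put 2 (Lit 0) (Lit 1)) (Then (Put 2 (Lit 1) (Lit 0))
 (Then (Put 3 (Lit 0) (Lit 0)) (Then (Put 3 (Lit 1) (Lit 1))
 (Then (Put 3 (Lit 2) (Lit 1)) (Put 3 (Lit 3) (Lit 0)))))))).

Lemma wp_emit_edge st : wp emit_edge 8 (represents^~ edge_instance) st.
Proof.
rewrite -[8]/(1 + (1 + (1 + (1 + (1 + (1 + (1 + 1))))))).
do 7![apply: (wp_then (Q1 := eq _)); [by apply: wp_put|move=> _ _ <-]].
apply: wp_put; split=> //=; first by case=> [[|[|//]]] lt; rewrite inE.
by case=> [[|[|//]]] lt [[|[|//]]] lt'; rewrite /edge_adj.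
Qed.

Definition emit_restrict : cmd :=
  Then (Rows 11 18)
 (Then (Vec 11 2 Skip (Get 15 (Get 10 (Var 5))))
 (Then (Mat 11 18 3 Skip
          (Get 16 (Plus (Get 8 (Get 10 (Var 4))) (Get 10 (Var 5)))))
       (Assign 0 (Var 11)))).

Definition emit_time n := 3 * n + 3 + (fill_time n 1 + (mat_time n 1 + 1)).

Lemma emit_time_mono m n : m <= n -> emit_time m <= emit_time n.
Proof. by move=> mn; rewrite /emit_time /mat_time /fill_time; nia. Qed.

Lemma wp_emit_restrict st I (R : {set 'I_(nv (gr I))}) :
  ready st I -> st 11 0 = #|R| -> (forall i : 'I_#|R|, st 10 i = enum_val i) ->
  wp emit_restrict (emit_time #|R|) (represents^~ (restrict R)) st.
Proof.
set m := #|R| => -[i0 i1 i8 i15 i16] i11 i10.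
apply: (wp_then (wp_rows (n := m) _ _ _)) => // st1 ag1 q1.
apply: (wp_then (wp_vec (T := 1) (n := m)
  (F := fun i : 'I_m => enum_val i \in seeds I) _ _ _ _ _)) => //.
- by rewrite ag1.
- move=> j st2 ag2 j5; apply: wp_skip.
  by rewrite /= j5 ag2 // ag1 // ag2 // ag1 // i10 i15.
move=> st2 ag2 q2.
apply: (wp_then (wp_mat (T := 1) (n := m)
  (F := fun i j : 'I_m => adj (enum_val i) (enum_val j)) _ _ _ _ _ _ _ _)) => //.
- by rewrite ag2 // ag1.
- by move=> u; rewrite ag2.
- move=> u v st3 ag3 u4 v5; apply: wp_skip => /=.
  have ag : agree [:: 2; 3; 4; 5; 18] st st3.
    apply: agree_trans (agree_sub _ ag1)
      (agree_trans (agree_sub _ ag2) (agree_sub _ ag3)) => y;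
      rewrite !inE; by do ?case: eqP.
  by rewrite u4 v5 !(ag 10) // !i10 (ag 8) // i8 (ag 16) // i16.
move=> st3 ag3 q3; apply: wp_put.
have ag : agree [:: 2; 3; 4; 5; 18] st st3.
  apply: agree_trans (agree_sub _ ag1)
      (agree_trans (agree_sub _ ag2) (agree_sub _ ag3)) => y;
      rewrite !inE; by do ?case: eqP.
split=> /=.
- by rewrite update_same /= ag // i11.
- by rewrite /update /= ag.
- by move=> v; rewrite inE /update /= ag3 // q2.
- by move=> u v; rewrite /update /= q3.
Qed.

(** * The whole program and its running time *)

Definition kernel_program (s : nat) : cmd :=
  Then prepare
 (Then (balls s)
 (Then (mark_reach s)
 (Then collect
 (Then threshold
       (If (Minus (Var 11) (Var 12)) emit_edge emit_restrict))))).

Definition kernel_time (s n : nat) : nat :=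
  3 * n + 3 + (fill_time n 1 + mat_time n 1)
  + (balls_time s n + (fill_time n (4 * n + 3)
  + (5 * n + 3 + (threshold_time n + (8 + emit_time n).+1)))).

(** A number at most [n] compares with [B] as it does with [B] capped at [n + 1], so the capped
    threshold gives the right decision. *)
Lemma subn_minn_eq0 r n B : r <= n -> (r - minn n.+1 B == 0) = (r <= B).
Proof. by rewrite subn_eq0 leq_min => /leqW->. Qed.

Lemma wp_kernel_program s st I : represents st I -> 0 < par I ->
  wp (kernel_program s) (kernel_time s (nv (gr I)))
     (represents^~ (kernelize s I)) st.
Proof.
move=> rep k0; set R := reach s (seeds I); set n := nv (gr I).
have Rn : #|R| <= n by rewrite -[n]card_ord max_card.
apply: (wp_then (wp_prepare rep)) => st1 _ rd1.
apply: (wp_then (wp_balls s rd1)) => st2 ag2 q2.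
have {}rd2 := ready_agree (balls_mods s) ag2 rd1.
apply: (wp_then (wp_mark_reach rd2 q2)) => st3 ag3 q3.
have rd3 : ready st3 I by apply: ready_agree ag3 rd2.
have [i0 _ _ _ _] := rd3.
apply: (wp_then (wp_collect i0 q3)) => st4 ag4 [c4 e4].
have rd4 : ready st4 I by apply: ready_agree ag4 rd3.
apply: (wp_then (wp_threshold rd4 k0)) => st5 ag5 q5.
have rd5 : ready st5 I by apply: ready_agree ag5 rd4.
have c5 : st5 11 0 = #|R| by rewrite ag5.
have e5 (i : 'I_#|R|) : st5 10 i = enum_val i by rewrite ag5.
rewrite /kernelize -/R; set B := par I ^ _ in q5 *.
apply: wp_if => [|/eqP]; rewrite /= c5 q5 subn_minn_eq0 //.
  rewrite -ltnNge => ->; apply: wp_weaken (leq_addr _ _) _ (wp_emit_edge st5) => //.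
rewrite leqNgt => /negbTE->; apply: wp_weaken _ _ (wp_emit_restrict rd5 c5 e5) => //.
exact: leq_trans (emit_time_mono Rn) (leq_addl _ _).
Qed.

Lemma kernel_time_cubic s n : kernel_time s n <= (100 + 20 * s) * n.+1 ^ 3.
Proof.
rewrite /kernel_time /balls_time /emit_time /threshold_time /mat_time /fill_time.
(* Cost of one layer of [balls]. It is bounded separately because it is multiplied by [s];
   afterwards both products with [s] are generalized to variables. *)
have le : n * (n * (4 * n + 3 + 1 + 2) + 2 + 2) + 2 <= 20 * n.+1 ^ 3.
  by rewrite !expnS expn0; nia.
rewrite mulnDl -mulnA mulnCA; have := leq_mul (leqnn s) le.
move: (s * _) (s * _) => x y xy.
have le' : 100 * n.+1 ^ 3 = 100 * (n * n * n) + 300 * (n * n) + 300 * n + 100.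
  by rewrite !expnS expn0; lia.
rewrite le'; move: xy; lia.
Qed.

(** * Machine stores and the encoding *)

Lemma nth_allpairs (S T U : Type) (f : S -> T -> U) x0 y0 z0 s t i j :
  i < size s -> j < size t ->
  nth z0 [seq f x y | x <- s, y <- t] (i * size t + j) = f (nth x0 s i) (nth y0 t j).
Proof.
elim: s i => [|x s IH] [|i] //= is_ jt; rewrite nth_cat size_map.
  by rewrite mul0n jt (nth_map y0).
rewrite mulSn -addnA ltnNge leq_addr /= addKn; exact: IH.
Qed.

Lemma load_adj I (u v : 'I_(nv (gr I))) : load I 3 (u * nv (gr I) + v) = adj u v.
Proof.
have := @nth_allpairs _ _ _ (fun x y => nat_of_bool (adj x y)) u u 0
  (enum 'I_(nv (gr I))) (enum 'I_(nv (gr I))) u v.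
by rewrite !size_enum_ord !nth_ord_enum => <-.
Qed.

Lemma load_seeds I (v : 'I_(nv (gr I))) : load I 2 v = (v \in seeds I).
Proof. by rewrite /load /= (nth_map v) ?size_enum_ord // nth_ord_enum. Qed.

Lemma represents_load I : represents (load I) I.
Proof. by split=> // *; rewrite ?load_adj ?load_seeds. Qed.

Lemma represents_holds st I : represents st I -> holds st I.
Proof.
move=> [i0 i1 i2 i3] [|[|[|[|a]]]] i //=.
- by case: i.
- by case: i.
- rewrite size_map size_enum_ord => lt.
  by rewrite -[i]/(val (Ordinal lt)) i2 load_seeds.
- rewrite size_allpairs size_enum_ord => lt.
  (* Quotient and remainder by the number of vertices recover the row and the column from the
     address. *)
  have n0 : 0 < nv (gr I) by case: (nv _) lt.
  have lu : i %/ nv (gr I) < nv (gr I) by rewrite ltn_divLR.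
  have lv : i %% nv (gr I) < nv (gr I) by rewrite ltn_pmod.
  by rewrite (divn_eq i (nv (gr I))) (i3 (Ordinal lu) (Ordinal lv))
    (load_adj (Ordinal lu) (Ordinal lv)).
by rewrite nth_nil.
Qed.

(** Every number of the encoding has bit length at least 1, and there are more than [nv (gr I)] of
    them. Strictness absorbs the [n.+1] of [kernel_time_cubic]. *)
Lemma input_size_gt I : nv (gr I) < input_size I.
Proof.
rewrite /input_size; have le (r : seq nat) : size r <= sumn [seq bit_length x | x <- r].
  by elim: r => //= x r IH; rewrite -add1n leq_add.
apply: leq_trans (le _); rewrite size_flatten /= size_map size_enum_ord; lia.
Qed.

Lemma kernelize_poly_time s : poly_time_on clique_instance (kernelize s).
Proof.
exists (kernel_program s), (100 + 20 * s), 3 => I [k0 _ _ _].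
have [st [t [ex le rep]]] := wp_kernel_program s (represents_load I) k0.
exists st, t; split=> //; first exact: represents_holds.
apply: leq_trans le (leq_trans (kernel_time_cubic _ _) _).
by rewrite leq_mul2l leq_exp2r // input_size_gt orbT.
Qed.

Theorem theorem5 (s : nat) (hs : 2 <= s) :
  exists2 f : instance -> instance,
    kernel clique_instance (seeded_club s) f &
    exists c : nat, forall I : instance, clique_instance I ->
      nv (gr (f I)) <= c * par I ^ (2 * #|seeds I| + 1).
Proof.
exists (kernelize s); last by exists 2 => I; apply: kernelize_size.
split.
- exact: kernelize_poly_time.
- by move=> I; apply: kernelize_clique.
- by move=> I; apply: kernelize_club.
- exists (fun k => 2 * k ^ (2 * k + 1) + (k + 2)) => I; exact: kernelize_bound.
Qed.
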